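(* Let $F$ be a forest with domination number $\gamma$. Then $F$ has at most $\sqrt{5}^{\,\gamma}$ minimum dominating sets, i.e. $\Gamma(F)\le \sqrt{5}^{\,\gamma}$.
   Context: For a graph $G$, a set $D\subseteq V(G)$ is dominating if every vertex of $G$ lies in $D$ or has a neighbour in $D$. The domination number $\gamma(G)$ is the minimum size of a dominating set; a dominating set of size $\gamma(G)$ is a minimum dominating set. $\Gamma(G)$ denotes the number of minimum dominating sets of $G$. *)

(* Defs.v *)
From mathcomp Require Import all_boot all_order all_algebra.
Set Implicit Arguments. Unset Strict Implicit. Unset Printing Implicit Defensive.

Definition simple_graph (T : finType) (e : rel T) : Prop :=
  symmetric e /\ irreflexive e.

Definition has_cycle (T : finType) (e : rel T) : Prop :=
  exists (x : T) (p : seq T),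
    [/\ 2 <= size p, uniq (x :: p), path e x p & e (last x p) x].

Definition forest (T : finType) (e : rel T) : Prop :=
  simple_graph e /\ ~ has_cycle e.

Definition dominating (T : finType) (e : rel T) (D : {set T}) : bool :=
  [forall v, (v \in D) || [exists u in D, e v u]].

(* Domination number: minimum size of a dominating set. The whole vertex set
   dominates and has size #|T|, so #|T| is a valid neutral element for minn. *)
Definition domination_number (T : finType) (e : rel T) : nat :=
  \big[minn/#|T|]_(D : {set T} | dominating e D) #|D|.

Definition num_min_dom_sets (T : finType) (e : rel T) : nat :=
  #|[set D : {set T} | dominating e D && (#|D| == domination_number e)]|.

(* Main.v *)
Require Import Defs.
From Stdlib Require Import NArith Lia.
From mathcomp Require Import all_boot all_order all_algebra zify.
Import Order.TTheory GRing.Theory Num.Theory.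
Set Implicit Arguments. Unset Strict Implicit. Unset Printing Implicit Defensive.

(** Root the trees of the forest.  What a minimum dominating set of the whole
    sees of a branch is its profile: the three leading counts of vertex sets
    that contain the root, dominate it from below, or leave it to its parent,
    together with the relative sizes of these sets (three kinds occur).  Adding
    an edge between two roots acts on profiles by polynomials with nonnegative
    coefficients, each homogeneous in the size, so it is monotone for the
    comparison of counts divided by sqrt 5 ^ size.  For this comparison the
    profiles obtained from a single vertex have only 37 maximal elements; that
    these are closed under the operation up to domination is a finite
    computation, and each of them satisfies the bound. *)

(** * Profiles of rooted forests and their grafting *)

(* Let gamma be the domination number of a rooted forest.  Some vertex set of
   size gamma - 1 dominates everything but the root ([Saving]); otherwise the
   root lies in some minimum dominating set ([Plain]) or in none ([Costly]). *)
Variant kind := Saving | Plain | Costly.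

(* [inn], [dmd], [fre] count the smallest sets that dominate everything except
   possibly the root and that, respectively, contain the root, omit but dominate
   it, omit and do not dominate it.  These sizes are [base + shift_in],
   [base + shift_dom] and [base]; a count may be zero at its size. *)
Record profile := Profile { knd : kind; base : N; inn : N; dmd : N; fre : N }.

Definition shift_in k : N := match k with Plain => 0 | _ => 1 end.
Definition shift_dom k : N := match k with Saving => 1 | _ => 0 end.

(* The smallest sets usable below a parent in the dominating set ([aided])
   or outside of it ([unaided]). *)
Definition aided p : N :=
  match knd p with
  | Saving => fre p
  | Plain => inn p + dmd p + fre p
  | Costly => dmd p + fre p
  end%num.

Definition unaided p : N :=
  match knd p with Costly => dmd p | _ => inn p + dmd p end%num.

Definition unaided_deg p : N := (base p + shift_dom (knd p))%num.

(* The profile after adding an edge from the root of [p] to the root of [q],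
   the root of [p] remaining the root. *)
Definition graft p q : profile :=
  let m := (base p + base q)%num in
  let a := (inn p * aided q)%num in
  let b1 := (dmd p * unaided q)%num in
  let b2 := (fre p * inn q)%num in
  let c := (fre p * dmd q)%num in
  match knd p, knd q with
  | Saving, Saving => Profile Plain (m + 1) a b2 c
  | Saving, Plain => Profile Costly m a b2 c
  | Saving, Costly => Profile Saving m a (b1 + b2) c
  | Plain, Saving => Profile Plain m a 0 0
  | Plain, Plain => Profile Plain m a (b1 + b2) c
  | Plain, Costly => Profile Plain m a b1 c
  | Costly, Saving => Profile Plain (m + 1) a (b1 + b2) c
  | Costly, Plain => Profile Costly m a (b1 + b2) c
  | Costly, Costly => Profile Costly m a b1 c
  end%num.

(** These counts must be nonzero for the kind and the domination number read off a profile to be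
    genuine. [inn] is asked of every kind because products with it become required counts after
    grafting. *)
Definition attained p : Prop :=
  inn p <> 0%num /\
  match knd p with
  | Saving => fre p <> 0%num | Plain => True | Costly => dmd p <> 0%num
  end.

Lemma graft_attained p q : attained p -> attained q -> attained (graft p q).
Proof.
case: p => [[] m1 a1 b1 c1]; case: q => [[] m2 a2 b2 c2]; rewrite /attained /=;
 rewrite /aided /unaided /=; nia.
Qed.

Lemma unaided_neq0 p : attained p -> unaided p <> 0%num.
Proof. case: p => [[] m a b c]; rewrite /attained /unaided /=; lia. Qed.

(** * Comparison of counts scaled by powers of sqrt 5 *)

(* [scaled_le m n x y] means x / sqrt 5 ^ m <= y / sqrt 5 ^ n. *)
Definition scaled_le (m n x y : N) : bool :=
  (x * x * 5 ^ n <=? y * y * 5 ^ m)%num.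

Lemma scaled_leM m n m' n' x y x' y' :
  scaled_le m n x y -> scaled_le m' n' x' y' ->
  scaled_le (m + m') (n + n') (x * x') (y * y').
Proof.
move=> /N.leb_le h /N.leb_le h'; apply/N.leb_le; rewrite !N.pow_add_r.
by have := N.mul_le_mono _ _ _ _ h h'; nia.
Qed.

Lemma scaled_leD m n x y x' y' :
  scaled_le m n x y -> scaled_le m n x' y' -> scaled_le m n (x + x') (y + y').
Proof.
move=> /N.leb_le h /N.leb_le h'; apply/N.leb_le.
(* The cross term of the expanded squares: squared, it is the product of the two hypotheses. *)
have hh : (x * x' * 5 ^ n <= y * y' * 5 ^ m)%num.
  apply: N.square_le_simpl_nonneg; first exact: N.le_0_l.
  by have := N.mul_le_mono _ _ _ _ h h'; nia.
nia.
Qed.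

Lemma scaled_le_trans m n k x y z :
  scaled_le m n x y -> scaled_le n k y z -> scaled_le m k x z.
Proof.
move=> /N.leb_le h /N.leb_le h'; apply/N.leb_le.
have h5 : (0 < 5 ^ n)%num by apply/N.neq_0_lt_0; apply: N.pow_nonzero.
apply/(N.mul_le_mono_pos_r _ _ (5 ^ n)) => //.
have := N.mul_le_mono_r _ _ (5 ^ k) h; have := N.mul_le_mono_r _ _ (5 ^ m) h'.
nia.
Qed.

Lemma scaled_le0 m n : scaled_le m n 0 0.
Proof. by []. Qed.

Lemma scaled_leS m n x y : scaled_le m n x y -> scaled_le (m + 1) (n + 1) x y.
Proof.
by move=> h; rewrite -[x]N.mul_1_r -[y]N.mul_1_r; apply: scaled_leM.
Qed.

Definition same_kind k l :=
  match k, l with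
  | Saving, Saving | Plain, Plain | Costly, Costly => true
  | _, _ => false
  end.

(** Equal kinds have equal shifts, so all three counts can be compared at [base]. *)
Definition profile_le p q : bool :=
  [&& same_kind (knd p) (knd q),
      scaled_le (base p) (base q) (inn p) (inn q),
      scaled_le (base p) (base q) (dmd p) (dmd q)
    & scaled_le (base p) (base q) (fre p) (fre q)].

Lemma profile_le_trans q p r :
  profile_le p q -> profile_le q r -> profile_le p r.
Proof.
move=> /and4P[k1 a1 b1 c1] /and4P[k2 a2 b2 c2]; apply/and4P; split.
- by case: (knd p) k1; case: (knd q) k2; case: (knd r).
- exact: scaled_le_trans a1 a2.
- exact: scaled_le_trans b1 b2.
- exact: scaled_le_trans c1 c2.
Qed.

(** Equal kinds select the same case of [graft]; only products, sums at a common size and the extra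
    [+ 1] remain. *)
Lemma graft_le p p' q q' :
  profile_le p p' -> profile_le q q' -> profile_le (graft p q) (graft p' q').
Proof.
case: p => k1 m1 a1 b1 c1; case: p' => k1' m1' a1' b1' c1'.
case: q => k2 m2 a2 b2 c2; case: q' => k2' m2' a2' b2' c2'.
rewrite /profile_le /=; case: k1; case: k1' => //= /and3P[ha hb hc];
  case: k2; case: k2' => //= /and3P[ha' hb' hc'];
  repeat (apply/andP; split) => //; rewrite /aided /unaided /= ?scaled_le0 //;
  try apply: scaled_leS; repeat (apply: scaled_leD || apply: scaled_leM);
  done.
Qed.

Lemma unaided_le p q : profile_le p q ->
  scaled_le (unaided_deg p) (unaided_deg q) (unaided p) (unaided q).
Proof.
case: p => k1 m1 a1 b1 c1; case: q => k1' m1' a1' b1' c1'.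
rewrite /profile_le /unaided /unaided_deg /=.
by case: k1; case: k1' => //= /and3P[ha hb hc]; rewrite ?N.add_0_r;
  try apply: scaled_leS; try apply: scaled_leD.
Qed.

(** * Extremal profiles and the finite check *)

(* The Pareto-maximal elements, after scaling by sqrt 5, of the closure of the
   first row (the one-vertex tree) under [graft]; each is realised by a tree. *)
Definition extremal : seq profile :=
  [::
    Profile Saving 0 1 0 1; Profile Saving 1 2 2 1; Profile Saving 2 3 5 1;
    Profile Saving 2 4 4 3; Profile Saving 3 7 11 3; Profile Saving 3 8 8 7;
    Profile Saving 4 16 24 9; Profile Saving 5 32 52 21;
    Profile Saving 6 64 112 49; Profile Plain 1 1 1 0; Profile Plain 2 1 2 2;
    Profile Plain 3 1 3 5; Profile Plain 3 2 6 2; Profile Plain 3 3 4 4;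
    Profile Plain 4 2 11 5; Profile Plain 4 3 7 11; Profile Plain 4 4 14 2;
    Profile Plain 4 6 12 4; Profile Plain 4 7 8 8; Profile Plain 5 6 25 11;
    Profile Plain 5 9 16 24; Profile Plain 5 12 28 4; Profile Plain 5 14 24 8;
    Profile Plain 6 18 56 24; Profile Plain 6 21 32 52;
    Profile Plain 7 42 116 52; Profile Plain 7 49 64 112;
    Profile Costly 1 2 1 1; Profile Costly 2 4 3 1; Profile Costly 2 5 1 2;
    Profile Costly 3 8 7 1; Profile Costly 3 10 2 6; Profile Costly 3 11 3 4;
    Profile Costly 4 20 4 14; Profile Costly 4 22 6 12;
    Profile Costly 4 23 7 8; Profile Costly 5 44 12 28
  ]%num.

Definition bounded p : bool := has (profile_le p) extremal.

Lemma all_has (A : Type) (a b : pred A) s :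
  all a s -> has b s -> exists2 x, a x & b x.
Proof.
elim: s => //= x s IHs /andP[ax as_] /orP[bx|]; first by exists x.
exact: IHs.
Qed.

Lemma bounded_graft p q : bounded p -> bounded q -> bounded (graft p q).
Proof.
(* Only pairs of extremal profiles are computed; [graft_le] transfers the result to all bounded
   ones. *)
have closed : all (fun p => all (fun q => bounded (graft p q)) extremal) extremal.
  by vm_cast_no_check (erefl true).
move=> /(all_has closed) [p' closed' le_p] /(all_has closed') [q' bpq le_q].
apply: sub_has bpq => r; apply: profile_le_trans; exact: graft_le.
Qed.

Lemma bounded_unaided p : bounded p -> scaled_le (unaided_deg p) 0 (unaided p) 1.
Proof.
have tot : all (fun q => scaled_le (unaided_deg q) 0 (unaided q) 1) extremal.
  by vm_cast_no_check (erefl true).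
move=> /(all_has tot) [q bq /unaided_le le_pq]; exact: scaled_le_trans le_pq bq.
Qed.

(** * Leading coefficients of polynomials *)

(** [a] may be 0, so [d] only bounds the order from below: a summand of higher order then counts as
    0 at size [d]. *)
Definition lead (d : nat) (p : {poly nat}) (a : nat) : Prop :=
  (forall k, k < d -> (p`_k)%R = 0) /\ (p`_d)%R = a.

Lemma lead_lt d d' p a : lead d p a -> d' < d -> lead d' p 0.
Proof.
move=> [z _] lt_d; split; last exact: z.
by move=> k lt_k; apply: z; apply: ltn_trans lt_d.
Qed.

Lemma leadD d p q a b :
  lead d p a -> lead d q b -> lead d (p + q)%R (a + b).
Proof.
move=> [zp <-] [zq <-]; split; last by rewrite coefD.
by move=> k lt_k; rewrite coefD zp // zq.
Qed.

Lemma leadM d d' p q a b :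
  lead d p a -> lead d' q b -> lead (d + d') (p * q)%R (a * b).
Proof.
move=> [zp <-] [zq <-]; split=> [k lt_k|].
  rewrite coefM big1 // => -[i /= lt_i] _.
  have [lt_id|le_di] := ltnP i d; first by rewrite zp // mul0r.
  by rewrite [(q`__)%R]zq ?mulr0 // ltn_subLR ?(leq_trans lt_k) ?leq_add2r // -ltnS.
rewrite coefM.
have lt_d : d < (d + d').+1 by rewrite ltnS leq_addr.
rewrite (bigD1 (Ordinal lt_d)) //= addKn big1 ?addr0 // => -[i lt_i] /=.
rewrite -val_eqE /= neq_ltn => /orP[lt_id|lt_di]; first by rewrite zp // mul0r.
by rewrite [(q`__)%R]zq ?mulr0 // ltn_subLR ?ltn_add2r // -ltnS.
Qed.

Lemma leadX d p a : lead d p a -> lead d.+1 ('X * p)%R a.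
Proof.
by move=> [z <-]; split=> [[|k] lt_k|]; rewrite coefXM //= z.
Qed.

Lemma lead_eq d d' p a a' :
  lead d p a -> d = d' -> a = a' -> lead d' p a'.
Proof. by move=> h <- <-. Qed.

Lemma leadD_eq d p q a b c :
  lead d p a -> lead d q b -> c = a + b -> lead d (p + q)%R c.
Proof. by move=> hp hq ->; apply: leadD. Qed.

Lemma nat_of_addN (m n : N) : (m + n)%num = m + n :> nat.
Proof. lia. Qed.

Lemma bigmin_leq (I : eqType) n (s : seq I) (P : pred I) (F : I -> nat) i :
  i \in s -> P i -> \big[minn/n]_(j <- s | P j) F j <= F i.
Proof.
elim: s => // j s IHs; rewrite inE big_cons => /predU1P[<- ->|/IHs le_i Pi].
  exact: geq_minl.
by case: ifP => _; rewrite ?geq_min le_i ?orbT.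
Qed.

(** * Generating polynomials of vertex sets by size *)

Section Counting.
Variables (T : finType) (e : rel T).
Hypothesis esym : symmetric e.
Implicit Types (S D : {set T}) (P Q : pred {set T}).

Definition gen S P : {poly nat} :=
  (\sum_(D : {set T} | (D \subset S) && P D) 'X^#|D|)%R.

Definition has_nbr D u := [exists w in D, e u w].
Definition dom_by D u := (u \in D) || has_nbr D u.
(** Neighbours are sought in the whole graph, but for [D] inside [S], as in [gen], this is
    domination in the subgraph induced on [S]. *)
Definition dom_all S D := [forall u in S, dom_by D u].

Definition st_in S r D := dom_all (S :\ r) D && (r \in D).
Definition st_dom S r D := [&& dom_all (S :\ r) D, r \notin D & has_nbr D r].
Definition st_free S r D := [&& dom_all (S :\ r) D, r \notin D & ~~ has_nbr D r].

Notation gin S r := (gen S (st_in S r)).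
Notation gdom S r := (gen S (st_dom S r)).
Notation gfree S r := (gen S (st_free S r)).
Notation tot S := (gen S (dom_all S)).

Lemma coef_gen S P k :
  ((gen S P)`_k)%R = #|[set D : {set T} | [&& D \subset S, P D & #|D| == k]]|.
Proof.
rewrite coef_sum -sum1dep_card [LHS]big_mkcond [RHS]big_mkcond /=.
apply: eq_bigr => D _; rewrite coefXn andbA eq_sym.
by case: (_ && _) => //=; case: eqP.
Qed.

Lemma gen_split S P Q R :
  (forall D, D \subset S -> P D = Q D || R D) ->
  (forall D, D \subset S -> ~~ (Q D && R D)) ->
  gen S P = (gen S Q + gen S R)%R.
Proof.
move=> hP dis; rewrite /gen !(big_mkcond (fun D => _ && _)) -big_split /=.
apply: eq_bigr => D _; case DS: (D \subset S); last by rewrite addr0.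
by move: (dis D DS); rewrite hP //=; case: (Q D); case: (R D); rewrite ?addr0 ?add0r.
Qed.

Lemma gen_pred0 S P : (forall D, D \subset S -> ~~ P D) -> gen S P = 0%R.
Proof.
move=> hP; apply: big_pred0 => D; case DS: (D \subset S) => //=.
exact/negbTE/hP.
Qed.

Section Product.
Variables (S1 S2 : {set T}).
Hypothesis disj : [disjoint S1 & S2].

Lemma setUIl_disj D1 D2 : D1 \subset S1 -> D2 \subset S2 ->
  (D1 :|: D2) :&: S1 = D1.
Proof.
move=> s1 s2; rewrite setIUl (setIidPl s1).
suff -> : D2 :&: S1 = set0 by rewrite setU0.
apply/eqP; rewrite setI_eq0 disjoint_sym.
exact: disjointWr s2 disj.
Qed.

Lemma setUIr_disj D1 D2 : D1 \subset S1 -> D2 \subset S2 ->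
  (D1 :|: D2) :&: S2 = D2.
Proof.
move=> s1 s2; rewrite setIUl (setIidPl s2).
suff -> : D1 :&: S2 = set0 by rewrite set0U.
apply/eqP; rewrite setI_eq0; exact: disjointWl s1 disj.
Qed.

(** Subsets of the disjoint union correspond to pairs of subsets by intersection, and sizes add. *)
Lemma gen_prod P P1 P2 :
  (forall D1 D2, D1 \subset S1 -> D2 \subset S2 ->
     P (D1 :|: D2) = P1 D1 && P2 D2) ->
  gen (S1 :|: S2) P = (gen S1 P1 * gen S2 P2)%R.
Proof.
move=> hP; rewrite /gen big_distrlr /= pair_big /=.
rewrite (reindex_onto (fun p : {set T} * {set T} => p.1 :|: p.2)
  (fun D => (D :&: S1, D :&: S2))) /=; last first.
  by move=> D /andP[DS _]; rewrite -setIUr; apply/setIidPl.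
rewrite [LHS]big_mkcond [RHS]big_mkcond; apply: eq_bigr => -[D1 D2] _ /=.
rewrite xpair_eqE.
(* A pair not inside [S1] and [S2] is not recovered from its union by intersection, so it
   contributes 0 on both sides. *)
case s1: (D1 \subset S1); last first.
  rewrite ifF //= andbC; apply/negbTE; apply: contraFN s1.
  by move=> /andP[/andP[/eqP <- _] _]; apply: subsetIr.
case s2: (D2 \subset S2); last first.
  rewrite ifF ?andbF //= andbC; apply/negbTE; apply: contraFN s2.
  by move=> /andP[/andP[_ /eqP <-] _]; apply: subsetIr.
rewrite setUIl_disj // setUIr_disj // !eqxx andbT setUSS //= hP //.
case: (P1 D1 && P2 D2) => //.
rewrite -exprD cardsU.
suff -> : D1 :&: D2 = set0 by rewrite cards0 subn0.
apply/eqP; rewrite setI_eq0.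
exact: disjointWl s1 (disjointWr s2 disj).
Qed.

End Product.

Lemma gen_cases S r :
  gen S (dom_all (S :\ r)) = (gin S r + gdom S r + gfree S r)%R.
Proof.
rewrite -(@gen_split S (fun D => st_in S r D || st_dom S r D)) => [|//|D _].
  apply: gen_split => D _; rewrite /st_in /st_dom /st_free;
  by case: dom_all; case: (r \in D); case: has_nbr.
by rewrite /st_in /st_dom; case: dom_all; case: (r \in D); case: has_nbr.
Qed.

Lemma dom_allD1 S r D : r \in S ->
  dom_all S D = dom_all (S :\ r) D && dom_by D r.
Proof.
move=> rS; apply/forall_inP/andP => [h|[/forall_inP h hr] u uS].
  by split; [apply/forall_inP => u /setD1P[_ /h]|apply: h].
by have [->//|ur] := eqVneq u r; apply: h; rewrite !inE ur.
Qed.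

Lemma tot_cases S r : r \in S -> tot S = (gin S r + gdom S r)%R.
Proof.
move=> rS; apply: gen_split => D _; rewrite /st_in /st_dom.
  rewrite (dom_allD1 _ rS) /dom_by.
  by case: dom_all; case: (r \in D); case: has_nbr.
by case: dom_all; case: (r \in D); case: has_nbr.
Qed.

Lemma dom_allU S1 S2 D : dom_all (S1 :|: S2) D = dom_all S1 D && dom_all S2 D.
Proof.
apply/forall_inP/andP => [h|[/forall_inP h1 /forall_inP h2] u].
  by split; apply/forall_inP => u uS; apply: h; rewrite inE uS ?orbT.
by case/setUP=> [/h1|/h2].
Qed.

Lemma has_nbrU D1 D2 u : has_nbr (D1 :|: D2) u = has_nbr D1 u || has_nbr D2 u.
Proof.
apply/exists_inP/orP => [[w /setUP[]wD euw]|[]/exists_inP[w wD euw]].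
- by left; apply/exists_inP; exists w.
- by right; apply/exists_inP; exists w.
- by exists w; rewrite // inE wD.
- by exists w; rewrite // inE wD orbT.
Qed.

Lemma has_nbr_sub D S u : D \subset S -> (forall w, w \in S -> ~~ e u w) ->
  has_nbr D u = false.
Proof.
move=> DS h; apply/negbTE/exists_inP => -[w /(subsetP DS) /h /negbTE -> //].
Qed.

(** * A root without neighbours *)

Section Isolated.
Variables (S : {set T}) (r : T).
Hypothesis rS : r \in S.
Hypothesis no_nbr : forall w, w \in S -> ~~ e r w.

Let SE : S = [set r] :|: (S :\ r). Proof. by rewrite setD1K. Qed.

Let disj : [disjoint [set r] & S :\ r].
Proof. by rewrite disjoints1 !inE eqxx. Qed.

Lemma isolated_dom_all D1 D2 : D1 \subset [set r] -> D2 \subset S :\ r ->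
  dom_all (S :\ r) (D1 :|: D2) = dom_all (S :\ r) D2.
Proof.
move=> s1 s2; apply: eq_forallb => u; case uS: (u \in _) => //=.
case/setD1P: uS => ur uS.
have uD1 : u \notin D1 by apply: contra ur => /(subsetP s1); rewrite inE.
rewrite /dom_by inE (negbTE uD1) has_nbrU (has_nbr_sub s1) // => w /set1P ->.
by rewrite esym no_nbr.
Qed.

Lemma isolated_in : gin S r = ('X * tot (S :\ r))%R.
Proof.
have -> : 'X%R = gen [set r] (fun D => r \in D).
  rewrite /gen (big_pred1 [set r]) ?cards1 // => D; rewrite subset1.
  have [->|] := eqVneq D [set r]; first by rewrite /= eqxx set11.
  by move=> /= /negbTE ->; case: eqP => //= ->; rewrite inE.
rewrite {1}SE; apply: gen_prod => // D1 D2 s1 s2.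
rewrite /st_in isolated_dom_all // andbC inE.
suff -> : r \in D2 = false by rewrite orbF.
by apply: contraTF s2 => rD; apply/subsetPn; exists r; rewrite // !inE eqxx.
Qed.

Lemma isolated_dom : gdom S r = 0%R.
Proof.
apply: gen_pred0 => D DS; rewrite /st_dom (has_nbr_sub DS) ?andbF //.
Qed.

Lemma isolated_free : gfree S r = tot (S :\ r).
Proof.
have e1 : 1%R = gen [set r] (fun D => r \notin D).
  rewrite /gen (big_pred1 set0) ?cards0 // => D; rewrite subset1.
  have [->|] := eqVneq D set0; first by rewrite /= eqxx inE orbT.
  by move=> /= /negbTE ->; rewrite orbF; case: eqP => //= ->; rewrite inE eqxx.
rewrite -[RHS]mul1r e1 {1}SE; apply: gen_prod => // D1 D2 s1 s2.
rewrite /st_free isolated_dom_all // (@has_nbr_sub _ S) //; last first.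
  by rewrite SE setUSS.
rewrite andbT andbC inE.
suff -> : r \in D2 = false by rewrite orbF.
by apply: contraTF s2 => rD; apply/subsetPn; exists r; rewrite // !inE eqxx.
Qed.

End Isolated.

(** * Two rooted pieces joined by one edge *)

Section Link.
Variables (S1 S2 : {set T}) (r v : T).
Hypotheses (disj : [disjoint S1 & S2]) (rS1 : r \in S1) (vS2 : v \in S2).
Hypothesis erv : e r v.
Hypothesis link : forall x y, x \in S1 -> y \in S2 -> e x y -> x = r /\ y = v.

Let S := S1 :|: S2.

Lemma link_setD1 : S :\ r = (S1 :\ r) :|: S2.
Proof.
rewrite /S setDUl; congr (_ :|: _); apply/setDidPl.
by rewrite disjoint_sym disjoints1 (disjointFr disj).
Qed.

Variables D1 D2 : {set T}.
Hypotheses (s1 : D1 \subset S1) (s2 : D2 \subset S2).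

Lemma link_notin1 u : u \in S1 -> u \in D2 = false.
Proof.
by move=> uS; apply: contraTF uS => /(subsetP s2) uS; rewrite (disjointFl disj).
Qed.

Lemma link_notin2 u : u \in S2 -> u \in D1 = false.
Proof.
by move=> uS; apply: contraTF uS => /(subsetP s1) uS; rewrite (disjointFr disj).
Qed.

Lemma link_nbr1 u : u \in S1 -> u != r -> has_nbr D2 u = false.
Proof.
move=> uS ur; apply: (has_nbr_sub s2) => w wS; apply: contraNN ur => euw.
by have [-> _] := link uS wS euw.
Qed.

Lemma link_nbr2 u : u \in S2 -> u != v -> has_nbr D1 u = false.
Proof.
move=> uS uv; apply: (has_nbr_sub s1) => w wS; apply: contraNN uv => euw.
by rewrite esym in euw; have [_ ->] := link wS uS euw.
Qed.

Lemma link_nbr_root : has_nbr D2 r = (v \in D2).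
Proof.
apply/exists_inP/idP => [[w wD erw]|vD]; last by exists v.
by have [_ <-] := link rS1 (subsetP s2 _ wD) erw.
Qed.

Lemma link_nbr_child : has_nbr D1 v = (r \in D1).
Proof.
apply/exists_inP/idP => [[w wD evw]|rD]; last by exists r; rewrite // esym.
by rewrite esym in evw; have [<- _] := link (subsetP s1 _ wD) vS2 evw.
Qed.

(** Apart from [r] and [v], every vertex can be dominated only from its own side; [v] may also be
    dominated by [r]. *)
Lemma link_dom_all :
  dom_all (S :\ r) (D1 :|: D2) =
  [&& dom_all (S1 :\ r) D1, dom_all (S2 :\ v) D2 & dom_by D2 v || (r \in D1)].
Proof.
rewrite link_setD1 dom_allU (dom_allD1 _ vS2).
congr [&& _, _ & _].
- apply: eq_forallb => u; case uS: (u \in _) => //=; case/setD1P: uS => ur uS.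
  by rewrite /dom_by inE has_nbrU link_nbr1 // link_notin1 // !orbF.
- apply: eq_forallb => u; case uS: (u \in _) => //=; case/setD1P: uS => uv uS.
  by rewrite /dom_by inE has_nbrU link_nbr2 // link_notin2.
- by rewrite /dom_by inE has_nbrU link_nbr_child link_notin2 //= orbCA orbC.
Qed.

Lemma link_root_in : r \in D1 :|: D2 = (r \in D1).
Proof. by rewrite inE link_notin1 // orbF. Qed.

Lemma link_root_nbr : has_nbr (D1 :|: D2) r = has_nbr D1 r || (v \in D2).
Proof. by rewrite has_nbrU link_nbr_root. Qed.

Lemma link_st_in :
  st_in S r (D1 :|: D2) = st_in S1 r D1 && dom_all (S2 :\ v) D2.
Proof.
rewrite /st_in link_root_in link_dom_all.
by case: (r \in D1); case: dom_all; case: dom_all; case: dom_by.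
Qed.

(** As [r] is not chosen, [D2] must dominate [v] itself. Either [r] has a chosen neighbour in [S1],
    or [v] is its only one. *)
Lemma link_st_dom :
  st_dom S r (D1 :|: D2) =
  (st_dom S1 r D1 && dom_all S2 D2) || (st_free S1 r D1 && st_in S2 v D2).
Proof.
rewrite /st_dom /st_free /st_in (dom_allD1 _ vS2) link_root_in link_root_nbr.
rewrite link_dom_all /dom_by.
by case: (r \in D1); case: (dom_all (S1 :\ r) D1); case: (dom_all (S2 :\ v) D2);
  case: (has_nbr D1 r); case: (v \in D2); case: (has_nbr D2 v).
Qed.

Lemma link_st_free :
  st_free S r (D1 :|: D2) = st_free S1 r D1 && st_dom S2 v D2.
Proof.
rewrite /st_dom /st_free link_root_in link_root_nbr link_dom_all /dom_by.
by case: (r \in D1); case: (dom_all (S1 :\ r) D1); case: (dom_all (S2 :\ v) D2);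
  case: (has_nbr D1 r); case: (v \in D2); case: (has_nbr D2 v).
Qed.

End Link.

Section LinkGen.
Variables (S1 S2 : {set T}) (r v : T).
Hypotheses (disj : [disjoint S1 & S2]) (rS1 : r \in S1) (vS2 : v \in S2).
Hypothesis erv : e r v.
Hypothesis link : forall x y, x \in S1 -> y \in S2 -> e x y -> x = r /\ y = v.

Lemma link_in : gin (S1 :|: S2) r =
  (gin S1 r * (gin S2 v + gdom S2 v + gfree S2 v))%R.
Proof.
rewrite -gen_cases //; apply: gen_prod => // D1 D2 s1 s2; exact: link_st_in.
Qed.

Lemma link_dom : gdom (S1 :|: S2) r =
  (gdom S1 r * (gin S2 v + gdom S2 v) + gfree S1 r * gin S2 v)%R.
Proof.
rewrite -tot_cases //.
(* The disjunction is not a product condition, but each alternative is; they exclude each other by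
   whether [r] has a neighbour in the [S1] part. *)
pose Q1 D := st_dom S1 r (D :&: S1) && dom_all S2 (D :&: S2).
pose Q2 D := st_free S1 r (D :&: S1) && st_in S2 v (D :&: S2).
rewrite (@gen_split _ _ Q1 Q2).
- congr (_ + _)%R; apply: gen_prod => // D1 D2 s1 s2;
  by rewrite /Q1 /Q2 (setUIl_disj disj) // (setUIr_disj disj).
- move=> D DS; rewrite /Q1 /Q2 -link_st_dom ?subsetIr // -setIUr.
  by rewrite (setIidPl DS).
- move=> D DS; rewrite /Q1 /Q2 /st_dom /st_free.
  by case: has_nbr; rewrite /= ?andbF.
Qed.

Lemma link_free : gfree (S1 :|: S2) r = (gfree S1 r * gdom S2 v)%R.
Proof. apply: gen_prod => // D1 D2 s1 s2; exact: link_st_free. Qed.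

End LinkGen.

(** * Profiles of rooted vertex sets *)

Definition fits S r p :=
  [/\ lead (base p + shift_in (knd p))%num (gin S r) (inn p),
      lead (base p + shift_dom (knd p))%num (gdom S r) (dmd p)
    & lead (base p) (gfree S r) (fre p)].

Lemma fits_aided S r p : fits S r p ->
  lead (base p) (gin S r + gdom S r + gfree S r)%R (aided p).
Proof.
case: p => [[] m a b c] [/= ha hb hc]; rewrite /aided /= ?nat_of_addN.
- rewrite -[X in lead _ _ X]/(0 + 0 + c); apply: leadD hc.
  by apply: leadD; [apply: lead_lt ha _|apply: lead_lt hb _]; lia.
- apply: leadD hc.
  by apply: leadD; [apply: lead_eq ha _ _|apply: lead_eq hb _ _]; lia.
- rewrite -[X in X + _]add0n; apply: leadD hc.
  by apply: leadD; [apply: lead_lt ha _|apply: lead_eq hb _ _]; lia.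
Qed.

Lemma fits_unaided S r p : r \in S -> fits S r p ->
  lead (unaided_deg p) (tot S) (unaided p).
Proof.
move=> rS; rewrite (tot_cases rS).
case: p => [[] m a b c] [/= ha hb hc]; rewrite /unaided /unaided_deg /= ?nat_of_addN.
- by apply: leadD; [apply: lead_eq ha _ _|apply: lead_eq hb _ _]; lia.
- by apply: leadD; [apply: lead_eq ha _ _|apply: lead_eq hb _ _]; lia.
- rewrite -[X in lead _ _ X]add0n.
  by apply: leadD; [apply: lead_lt ha _|apply: lead_eq hb _ _]; lia.
Qed.

(** The sizes of the products in the link formulas decide the kind of the result; a product missing
    from [graft] has too large a size to be leading. *)
Lemma fits_graft S1 S2 r v p q :
  [disjoint S1 & S2] -> r \in S1 -> v \in S2 -> e r v ->
  (forall x y, x \in S1 -> y \in S2 -> e x y -> x = r /\ y = v) ->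
  fits S1 r p -> fits S2 v q -> fits (S1 :|: S2) r (graft p q).
Proof.
move=> disj rS vS erv link fp fq.
have hcov := fits_aided fq; have htot := fits_unaided vS fq.
rewrite (tot_cases vS) in htot.
rewrite /fits (link_in disj rS vS erv link) (link_dom disj rS vS erv link).
rewrite (link_free disj rS vS erv link).
move: fp fq => [ha hb hc] [ha' hb' hc'].
have hA := leadM ha hcov.
have hB1 := leadM hb htot; have hB2 := leadM hc ha'.
have hC := leadM hc hb'.
clear hb hc ha' hb' hc' hcov htot ha.
case: p hA hB1 hB2 hC => k1 m1 a1 b1 c1; case: q => k2 m2 a2 b2 c2.
rewrite /graft /unaided_deg /=.
move: (aided _) (unaided _) => cv tt.
move: (gin S1 r * _)%R (gdom S1 r * _)%R (gfree S1 r * gin S2 v)%R (gfree S1 r * _)%R.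
move=> A B1 B2 C.
by case: k1 => /=; case: k2 => /= hA hB1 hB2 hC; split=> /=;
  (* The alternatives are a single product at its exact size or above it, then a sum with both terms
     above, both exact, or just one above. *)
  first [ apply: lead_eq hA _ _; lia | apply: lead_eq hC _ _; lia
  | apply: (@lead_lt _ _ _ _ hC); lia
  | apply: (@leadD_eq _ _ _ 0 0); [apply: lead_lt hB1 _|apply: lead_lt hB2 _|]; lia
  | eapply leadD_eq; [apply: lead_eq hB1 _ erefl|apply: lead_eq hB2 _ erefl|]; lia
  | eapply (@leadD_eq _ _ _ 0); [apply: lead_lt hB1 _|apply: lead_eq hB2 _ erefl|]; lia
  | eapply (@leadD_eq _ _ _ _ 0); [apply: lead_eq hB1 _ erefl|apply: lead_lt hB2 _|]; lia ].
Qed.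

(** As [t] is nonzero, [d] is the domination number of the subgraph induced on [S] and [t] its
    number of minimum dominating sets. *)
Definition tot_bounded S :=
  exists d t : N, [/\ lead d (tot S) t, t <> 0%num & scaled_le d 0 t 1].

Definition rooted_bounded S r :=
  exists p, [/\ bounded p, attained p & fits S r p].

Lemma tot_bounded0 : tot_bounded set0.
Proof.
exists 0%num, 1%num; split=> //; split=> //=.
rewrite /gen (big_pred1 set0) ?cards0 ?coefXn // => D /=.
rewrite subset0 andb_idr // => _; apply/forall_inP => u; by rewrite inE.
Qed.

Lemma rooted_tot_bounded S r : r \in S -> rooted_bounded S r -> tot_bounded S.
Proof.
move=> rS [p [bp pp fp]]; exists (unaided_deg p), (unaided p); split.
- exact: fits_unaided rS fp.
- exact: unaided_neq0.
- exact: bounded_unaided.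
Qed.

(** The rest of [S] multiplies the one-vertex profile by [t] and raises its size by [d]; since [t]
    is at most sqrt 5 ^ [d], the first extremal profile still dominates. *)
Lemma isolated_rooted_bounded S r : r \in S ->
  (forall w, w \in S -> ~~ e r w) -> tot_bounded (S :\ r) -> rooted_bounded S r.
Proof.
move=> rS iso [d [t [tS t0 tle]]]; exists (Profile Saving d t 0 t); split.
- have le1 : profile_le (Profile Saving d t 0 t) (Profile Saving 0 1 0 1).
    by apply/and4P; split.
  by apply/orP; left.
- by split.
split=> /=.
- by rewrite isolated_in //; apply: lead_eq (leadX tS) _ _; lia.
- by rewrite isolated_dom //; split=> [k _|]; rewrite coef0.
- by rewrite isolated_free.
Qed.

(** * Splitting off the branch at a neighbour of the root *)

Section Split.
Variables (S : {set T}) (r v : T).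
Hypotheses (acyclic : ~ has_cycle e) (rS : r \in S) (vS : v \in S) (erv : e r v).
Hypothesis rv : v != r.

Let e' := [rel x y | [&& e x y, x \in S :\ r & y \in S :\ r]].

Definition branch : {set T} := [set w | connect e' v w].

Lemma branch_path x p : path e' x p -> path e x p && all (mem (S :\ r)) p.
Proof.
elim: p x => //= y p IHp x /andP[/and3P[-> _ yS] /IHp/andP[pe pS]].
by rewrite yS pe.
Qed.

Lemma branch_sub : branch \subset S :\ r.
Proof.
apply/subsetP => w; rewrite inE => /connectP[p /branch_path/andP[_ /allP pS] ->].
have := mem_last v p; rewrite inE => /predU1P[->|/pS //].
by rewrite !inE rv.
Qed.

(** An edge from any other vertex than [r] would enlarge the component [branch]; a second edge from
    [r] would close a cycle. *)
Lemma branch_link x y :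
  x \in S :\: branch -> y \in branch -> e x y -> x = r /\ y = v.
Proof.
move=> /setDP[xS xB] yB exy.
have yS := subsetP branch_sub y yB.
have xr : x = r.
  apply/eqP; apply: contraNT xB => xr; rewrite inE.
  rewrite inE in yB; apply: connect_trans yB _; apply: connect1.
  by rewrite /= esym exy yS !inE xr.
split=> //; subst x; apply/eqP; apply/negP => /negP yv.
move: yB; rewrite inE => /connectP[p0 pth0 ylast].
case: (shortenP pth0) ylast => p pth up _ ylast.
have /andP[pe /allP pS] := branch_path pth.
(* The path from [v] to [y] avoids [r] and is not trivial, so closing it through [r] gives at least
   three vertices. *)
apply: acyclic; exists r, (v :: p); split.
- by case: p ylast {pth up pe pS} => //= yv'; rewrite yv' eqxx in yv.
- rewrite cons_uniq up andbT inE negb_or eq_sym rv.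
  by apply/negP => /pS; rewrite !inE eqxx.
- by rewrite /= erv pe.
- by rewrite /= -ylast esym.
Qed.

End Split.

(** Induction on the size of [S]: if [r] has a neighbour [v], cut off its branch and graft it back;
    otherwise choose any new root in the rest. *)
Lemma forest_rooted_bounded S r : irreflexive e -> ~ has_cycle e ->
  r \in S -> rooted_bounded S r.
Proof.
move=> eirr acyclic; have [n] := ubnP #|S|.
elim: n => // n IHn in S r *; rewrite ltnS => leSn rS.
have small S' x : S' \subset S -> x \in S -> x \notin S' -> #|S'| < n.
  move=> sS xS xS'; apply: leq_trans leSn; apply: proper_card.
  by apply/properP; split=> //; exists x.
case: (pickP [pred w in S | e r w]) => [v /= /andP[vS erv]|iso]; last first.
  apply: isolated_rooted_bounded => // [w wS|].
    by have /= := iso w; rewrite wS /= => ->.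
  have [->|[v vS]] := set_0Vmem (S :\ r); first exact: tot_bounded0.
  apply: (rooted_tot_bounded vS); apply: IHn => //.
  by apply: (small _ r) => //; rewrite ?subD1set // !inE eqxx.
have rv : v != r by apply: contraTneq erv => ->; rewrite eirr.
pose B := branch S r v.
have sB : B \subset S :\ r := branch_sub vS rv.
have sBS : B \subset S by apply: subset_trans sB (subD1set _ _).
have rB : r \notin B by apply/negP => /(subsetP sB); rewrite !inE eqxx.
have vB : v \in B by rewrite inE connect0.
have rS1 : r \in S :\: B by rewrite inE rB.
have disj : [disjoint S :\: B & B].
  by rewrite -setI_eq0 setIDAC setDIl setDv setI0.
have [p [bp pp fp]] : rooted_bounded (S :\: B) r.
  by apply: IHn => //; apply: (small _ v) => //; rewrite ?subsetDl // inE vB.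
have [q [bq pq fq]] : rooted_bounded B v.
  by apply: IHn => //; apply: (small _ r).
exists (graft p q); split; [exact: bounded_graft|exact: graft_attained|].
have -> : S = (S :\: B) :|: B by rewrite setUC -{1}(setIidPr sBS) setID.
apply: (fits_graft disj rS1 vB erv) fp fq => x y.
exact: branch_link.
Qed.

Lemma forest_tot_bounded S : irreflexive e -> ~ has_cycle e -> tot_bounded S.
Proof.
move=> eirr acyclic; have [->|[r rS]] := set_0Vmem S; first exact: tot_bounded0.
exact: rooted_tot_bounded rS (forest_rooted_bounded eirr acyclic rS).
Qed.

(** * From leading coefficients to the domination number *)

Lemma dominatingE D : dominating e D = dom_all setT D.
Proof. by apply: eq_forallb => u; rewrite in_setT. Qed.

Lemma lead_domination_number d a :
  lead d (tot setT) a -> a != 0 ->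
  domination_number e = d /\ num_min_dom_sets e = a.
Proof.
move=> [z def_a] a0.
have min_d D : dominating e D -> d <= #|D|.
  move=> domD; rewrite leqNgt; apply/negP => /z; rewrite coef_gen.
  by apply/eqP; rewrite cards_eq0; apply/set0Pn; exists D;
     rewrite inE subsetT -dominatingE domD eqxx.
have count_d : #|[set D | dominating e D && (#|D| == d)]| = a.
  by rewrite -def_a coef_gen; apply: eq_card => D; rewrite !inE subsetT dominatingE.
have dn : domination_number e = d; last by rewrite /num_min_dom_sets dn.
apply/eqP; rewrite eqn_leq; apply/andP; split.
  move: a0; rewrite -count_d cards_eq0 => /set0Pn[D]; rewrite inE => /andP[domD].
  by move=> /eqP <-; apply: bigmin_leq => //; rewrite mem_index_enum.
rewrite /domination_number; elim/big_ind: _ => [|m n lem len|D]; last exact: min_d.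
(* The default value [#|T|] of the minimum is the size of the full vertex set, which is
   dominating. *)
- rewrite -cardsT; apply: min_d; apply/forallP => u; by rewrite inE.
- by rewrite leq_min lem len.
Qed.

End Counting.

Local Open Scope ring_scope.

Theorem mainTheorem1 (R : rcfType) (T : finType) (e : rel T) :
  forest e ->
  (num_min_dom_sets e)%:R <= (Num.sqrt (5 : R)) ^+ (domination_number e).
Proof.
move=> [[esym eirr] acyclic].
have [d [t [tT t0 /N.leb_le tle]]] := forest_tot_bounded esym setT eirr acyclic.
have [-> ->] : domination_number e = d /\ num_min_dom_sets e = t.
  by apply: lead_domination_number => //; lia.
have tt5 : (t ^ 2 <= 5 ^ d)%N by lia.
(* Both sides are nonnegative, so squaring reduces the claim to [tt5]. *)
rewrite -ler_sqr ?nnegrE ?ler0n ?exprn_ge0 ?sqrtr_ge0 //.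
by rewrite -exprM mulnC exprM sqr_sqrtr ?ler0n // -!natrX ler_nat.
Qed.
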